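(* Let $V$ be a finite set with $n=|V|$ and let $\mathcal{P}=(P_t)_{t\ge1}$ be a sequence of transition matrices on $V$ (not necessarily having a time-homogeneous stationary distribution). Consider the pull voting according to $\mathcal{P}$ in which initially all vertices have $n$ distinct opinions. Then there is a sequence $(\mathcal{Q}^{(i)})_{i\ge0}$, where each $\mathcal{Q}^{(i)}=(Q^{(i)}_t)_{t\ge1}$ is a sequence of transition matrices on $V$, such that for every integer $j\ge0$, $$\Pr[\tau_{\mathrm{cons}}(\mathcal{P})\le j]=\Pr[\tau_{\mathrm{coal}}(\mathcal{Q}^{(j)})\le j].$$ Moreover, if $\mathcal{P}$ is reversible and has the time-invariant stationary distribution $\pi$ (i.e. every $P_t$ is reversible with stationary distribution $\pi$), then so do the sequences $\mathcal{Q}^{(i)}$ for all $i$.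
   Context: A transition matrix on $V$ is a row-stochastic matrix in $[0,1]^{V\times V}$. It is reversible with respect to $\pi$ if $\pi(u)P(u,v)=\pi(v)P(v,u)$ for all $u,v$. Pull voting according to $\mathcal{P}$: each vertex holds an opinion. At round $t\ge1$, simultaneously and independently, each vertex $u$ picks a vertex $v$ according to $P_t(u,\cdot)$ and replaces its opinion by the opinion that $v$ held at the beginning of the round. $\tau_{\mathrm{cons}}(\mathcal{P})$ is the first time $t\ge0$ at which all vertices hold the same opinion. Coalescing random walk according to $\mathcal{Q}=(Q_t)_{t\ge1}$: initially there is exactly one walker on each vertex of $V$. At step $t\ge1$, all walkers located at the same vertex $u$ move together to one vertex sampled from $Q_t(u,\cdot)$, independently for distinct $u$. $\tau_{\mathrm{coal}}(\mathcal{Q})$ is the first time $t\ge0$ at which all walkers are at a single vertex. *)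

(* Defs.v *)
From HB Require Import structures.
From mathcomp Require Import all_boot all_order all_algebra.
From mathcomp Require Import all_classical all_reals all_analysis.

Set Implicit Arguments.
Unset Strict Implicit.
Unset Printing Implicit Defensive.

Import Order.TTheory GRing.Theory Num.Theory.

Local Open Scope classical_set_scope.
Local Open Scope ring_scope.

Section Matrices.
Context {R : realType} {V : finType}.

Definition transition_matrix (P : V -> V -> R) : Prop :=
  (forall u v, 0 <= P u v <= 1) /\ (forall u, \sum_v P u v = 1).

(* Sequences (P_t)_{t >= 1} are functions on nat whose value at 0 is unused. *)
Definition transition_sequence (P : nat -> V -> V -> R) : Prop :=
  forall t, (0 < t)%N -> transition_matrix (P t).

Definition distribution_on (pi : V -> R) : Prop :=
  (forall u, 0 <= pi u) /\ \sum_u pi u = 1.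

Definition stationary (pi : V -> R) (P : V -> V -> R) : Prop :=
  forall v, \sum_u pi u * P u v = pi v.

Definition reversible (pi : V -> R) (P : V -> V -> R) : Prop :=
  forall u v, pi u * P u v = pi v * P v u.

Definition reversible_stationary_sequence
    (pi : V -> R) (P : nat -> V -> V -> R) : Prop :=
  distribution_on pi /\
  forall t, (0 < t)%N -> reversible pi (P t) /\ stationary pi (P t).

End Matrices.

Section Processes.
Context {R : realType} {d : measure_display} {T : measurableType d}.
Context {V : finType} (Pr : probability T R).

Definition mutually_independent {I : eqType} (D : set I) (X : I -> T -> V) :
    Prop :=
  forall (s : seq I) (A : I -> set V),
    uniq s -> [set` s] `<=` D ->
    Pr (\bigcap_(i in [set` s]) (X i @^-1` A i)) =
    (\prod_(i <- s) Pr (X i @^-1` A i))%E.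

(* [C t u] is the vertex drawn from [P t u] at vertex [u] in round [t >= 1];
   all the draws, over all rounds and vertices, are mutually independent. *)
Definition random_choices (P : nat -> V -> V -> R) (C : nat -> V -> T -> V) :
    Prop :=
  [/\ forall t u v, (0 < t)%N -> measurable (C t u @^-1` [set v]),
      forall t u v, (0 < t)%N -> Pr (C t u @^-1` [set v]) = (P t u v)%:E
    & mutually_independent [set i : nat * V | (0 < i.1)%N]
        (fun i => C i.1 i.2)].

(* [X t u w] is the opinion of vertex [u] after [t] rounds. *)
Definition pull_voting {O : Type} (P : nat -> V -> V -> R) (x0 : V -> O)
    (X : nat -> V -> T -> O) : Prop :=
  exists2 C, random_choices P C &
    (forall u w, X 0 u w = x0 u) /\
    (forall t u w, X t.+1 u w = X t (C t.+1 u w) w).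

(* [W t i w] is the position after [t] steps of the walker that starts at
   vertex [i].  A destination is drawn at every vertex; the draws at
   unoccupied vertices have no effect. *)
Definition coalescing_walk (Q : nat -> V -> V -> R) (W : nat -> V -> T -> V) :
    Prop :=
  exists2 M, random_choices Q M &
    (forall i w, W 0 i w = i) /\
    (forall t i w, W t.+1 i w = M t.+1 (W t i w) w).

(* Equal to +oo if the event never occurs. *)
Definition first_time (E : nat -> set T) (w : T) : \bar R :=
  ereal_inf [set t%:R%:E | t in [set t | E t w]].

Definition all_equal {O : Type} (X : nat -> V -> T -> O) (t : nat) : set T :=
  [set w | forall u v, X t u w = X t v w].

Definition tau_cons {O : Type} (X : nat -> V -> T -> O) : T -> \bar R :=
  first_time (all_equal X).

Definition tau_coal (W : nat -> V -> T -> V) : T -> \bar R :=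
  first_time (all_equal W).

End Processes.

(* Main.v *)
Require Import Defs.
From HB Require Import structures.
From mathcomp Require Import all_boot all_order all_algebra.
From mathcomp Require Import all_classical all_reals all_analysis.

(**
  After j rounds the opinion of u is that of the vertex C_1(C_2(...C_j(u))),
  where C_t is the random map drawn in round t, while after j steps the walker
  started at u is at M_j(...M_1(u)).  Take for Q^(j) the time reversal of
  P_1, ..., P_j.  Then (M_j, ..., M_1) has the law of (C_1, ..., C_j), so the
  two compositions have the same law; in either process "all equal by time j"
  says that the composition is constant, the initial opinions being distinct.
*)

Set Implicit Arguments.
Unset Strict Implicit.
Unset Printing Implicit Defensive.

Import Order.TTheory GRing.Theory Num.Theory.

Local Open Scope classical_set_scope.
Local Open Scope ring_scope.

Section Compositions.
Context {V : Type}.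
Implicit Types C M : nat -> V -> V.

Fixpoint backward_comp C (t : nat) (u : V) : V :=
  if t is t'.+1 then backward_comp C t' (C t u) else u.

Fixpoint forward_comp M (t : nat) (u : V) : V :=
  if t is t'.+1 then M t (forward_comp M t' u) else u.

(** Peeling off the first map instead of the last matches the recursion of [backward_comp], which
    applies its highest-numbered map first. *)
Lemma forward_compSr M t u :
  forward_comp M t.+1 u = forward_comp (fun s => M s.+1) t (M 1 u).
Proof. by elim: t => //= t <-. Qed.

Lemma eq_backward_comp C C' j :
  (forall t u, (t < j)%N -> C t.+1 u = C' t.+1 u) ->
  backward_comp C j =1 backward_comp C' j.
Proof.
elim: j => //= j IH eqC u; rewrite eqC //; apply: IH => t v tj.
by rewrite eqC // ltnW.
Qed.

Lemma forward_comp_rev C M j :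
  (forall t u, (t < j)%N -> M (j - t)%N u = C t.+1 u) ->
  forward_comp M j =1 backward_comp C j.
Proof.
elim: j M => // j IH M eqM u; rewrite forward_compSr /= -eqM // subSnn.
by apply: IH => t v tj; rewrite -eqM ?subSn // ltnW.
Qed.

End Compositions.

Section FirstTime.
Context {R : realType} {d : measure_display} {T : measurableType d}.

(** Once [E] has occurred it persists, so a first occurrence by time [j] amounts to [E] holding at
    time [j] itself. *)
Lemma first_time_leP (E : nat -> set T) (j : nat) (w : T) :
  (forall t, E t w -> E t.+1 w) ->
  (first_time E w <= (j%:R : R)%:E)%E <-> E j w.
Proof.
move=> Emono; split=> [Ej|Ej]; last by apply: ereal_inf_lbound; exists j.
apply: contrapT => nEj; move: Ej; apply/negP; rewrite -ltNge.
(* If [E j] fails, every time at which [E] holds is at least [j.+1], and so is the infimum, even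
   when it is taken over the empty set. *)
apply: (@lt_le_trans _ _ (j.+1%:R : R)%:E); first by rewrite lte_fin ltr_nat.
apply: le_ereal_inf_tmp => _ [t /= Et <-]; rewrite lee_fin ler_nat ltnNge.
apply/negP => tj; apply: nEj; rewrite -(subnK tj).
by elim: (j - t)%N => //= k; rewrite addSn => /Emono.
Qed.

End FirstTime.

Section JointLaw.
Context {R : realType} {d : measure_display} {T : measurableType d}.
Context {V I : finType} (Pr : probability T R).

Definition atom (Y : I -> T -> V) (f : {ffun I -> V}) : set T :=
  \bigcap_(i in setT) (Y i @^-1` [set f i]).

Lemma atomP (Y : I -> T -> V) f w : atom Y f w <-> [ffun i => Y i w] = f.
Proof.
split=> [Yf|<- i _]; last by rewrite /= ffunE.
by apply/ffunP => i; rewrite ffunE; exact: Yf.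
Qed.

(** The atoms are pairwise disjoint and finite in number, and the event is the union of those
    indexed by [B]. *)
Lemma measure_atoms (Y : I -> T -> V) (B : set {ffun I -> V}) :
  (forall i v, measurable (Y i @^-1` [set v])) ->
  Pr [set w | B [ffun i => Y i w]] = (\sum_(f \in B) Pr (atom Y f))%E.
Proof.
move=> mY; rewrite -measure_fin_bigcup.
- congr (Pr _); apply/seteqP; split => w /=.
    by move=> BY; exists [ffun i => Y i w] => //; apply/atomP.
  by move=> [f Bf /atomP ->].
- exact: finite_finset.
- by move=> f g _ _ [w [/atomP <- /atomP <-]].
- by move=> f _; apply: fin_bigcap_measurable => // i _; exact: mY.
Qed.

Lemma random_choices_atom (P : nat -> V -> V -> R) (C : nat -> V -> T -> V)
    (e : I -> nat * V) (f : {ffun I -> V}) :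
  random_choices Pr P C -> injective e -> (forall i, (0 < (e i).1)%N) ->
  Pr (atom (fun i => C (e i).1 (e i).2) f) =
  (\prod_i (P (e i).1 (e i).2 (f i))%:E)%E.
Proof.
move=> [_ lawC indC] einj epos.
(* Independence takes a family of sets over all of [nat * V]. This one is the singleton of [f i] at
   [e i], by injectivity of [e], and all of [V] off the image of [e]. *)
pose A k := [set v | forall i, e i = k -> v = f i].
have Ae i : A (e i) = [set f i].
  by apply/seteqP; split => [v /(_ i)|v -> i' /einj ->] //; exact.
have := indC [seq e i | i <- enum I] A _ _.
rewrite map_inj_uniq ?enum_uniq // => /(_ isT) indA.
have {indA} := indA _; rewrite big_map big_enum /= => indA.
transitivity (\prod_i Pr (C (e i).1 (e i).2 @^-1` A (e i)))%E; last first.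
  by apply: eq_bigr => i _; rewrite Ae lawC.
rewrite -indA; last by move=> k /= /mapP[i _ ->]; exact: epos.
congr (Pr _); apply/seteqP; split => w /=.
  by move=> Yw _ /= /mapP[i _ ->]; rewrite Ae; exact: Yw.
move=> Yw i _; have := Yw (e i); rewrite Ae; apply.
by rewrite /= map_f // mem_enum.
Qed.

End JointLaw.

Section TimeReversal.
Context {R : realType} {V : finType}.

(* Steps after [j] do not matter; there any transition matrix reversible for
   the same distributions will do. *)
Definition time_reversal (P : nat -> V -> V -> R) (j t : nat) : V -> V -> R :=
  P (if (t <= j)%N then (j.+1 - t)%N else t).

(** Nothing is assumed about [P 0], so the reversal must never read it at a positive time. *)
Lemma time_reversal_index_gt0 (j t : nat) :
  (0 < t)%N -> (0 < if (t <= j)%N then (j.+1 - t)%N else t)%N.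
Proof. by case: ifP => // tj _; rewrite subn_gt0. Qed.

(* Indexing the choices by [(t, u)] with [t < j], [forward_index] stands for
   round [t.+1] of the voting and [backward_index] for the step [j - t] of the
   reversed walk, which uses the same matrix. *)
Definition forward_index (j : nat) (i : 'I_j * V) : nat * V := (i.1.+1, i.2).
Definition backward_index (j : nat) (i : 'I_j * V) : nat * V :=
  ((j - i.1)%N, i.2).

Lemma forward_index_inj j : injective (@forward_index j).
Proof. by move=> [s u] [t v] [/val_inj -> ->]. Qed.

Lemma backward_index_inj j : injective (@backward_index j).
Proof.
move=> [s u] [t v] [st ->]; congr (_, _); apply: val_inj => /=.
by rewrite -(subKn (ltnW (ltn_ord s))) st subKn // ltnW.
Qed.

(** The step [j - i.1] is at most [j], so it is reversed to [j.+1 - (j - i.1) = i.1.+1]. *)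
Lemma time_reversal_backward P j (i : 'I_j * V) :
  time_reversal P j (backward_index i).1 = P (forward_index i).1.
Proof.
by rewrite /time_reversal leq_subr subSn ?leq_subr // subKn // ltnW.
Qed.

(** Turns a finite table of draws back into a sequence of maps: round [t] reads row [t.-1], and
    rounds after [j] default to the identity. *)
Definition choice_maps (j : nat) (f : {ffun 'I_j * V -> V}) (t : nat) (u : V) :
    V :=
  if insub t.-1 is Some s then f (s, u) else u.

Lemma choice_mapsE j (g : 'I_j * V -> V) t (tj : (t < j)%N) u :
  choice_maps [ffun i => g i] t.+1 u = g (Ordinal tj, u).
Proof. by rewrite /choice_maps /= insubT ffunE. Qed.

Definition constant_comp (j : nat) : set {ffun 'I_j * V -> V} :=
  [set f | forall u v, backward_comp (choice_maps f) j u =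
                       backward_comp (choice_maps f) j v].

End TimeReversal.

Lemma tau_cons_le (R : realType) (d : measure_display) (T : measurableType d)
    (V : finType) (O : Type) (x0 : V -> O) (X : nat -> V -> T -> O)
    (C : nat -> V -> T -> V) (j : nat) :
  injective x0 -> (forall u w, X 0 u w = x0 u) ->
  (forall t u w, X t.+1 u w = X t (C t.+1 u w) w) ->
  [set w | (tau_cons X w <= (j%:R : R)%:E)%E] =
  [set w | constant_comp
     [ffun i : 'I_j * V => C (forward_index i).1 (forward_index i).2 w]].
Proof.
move=> x0inj X0 XS; apply: eq_set => w; apply/propext.
have Xcomp t u : X t u w = x0 (backward_comp (fun s v => C s v w) t u).
  by elim: t u => [|t IH] u; rewrite ?X0 ?XS ?IH.
have maps u : X j u w = x0 (backward_comp (choice_maps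
    [ffun i : 'I_j * V => C (forward_index i).1 (forward_index i).2 w]) j u).
  rewrite Xcomp; congr x0; apply: eq_backward_comp => t v tj.
  by rewrite (choice_mapsE _ tj).
(* Consensus persists, since every opinion after a round was already held before it. *)
rewrite first_time_leP => [|t Xt u v]; last by rewrite !XS; exact: Xt.
split=> [Xj u v|Xj u v]; first by apply: x0inj; rewrite -!maps.
by rewrite !maps (Xj u v).
Qed.

Lemma tau_coal_le (R : realType) (d : measure_display) (T : measurableType d)
    (V : finType) (W : nat -> V -> T -> V) (M : nat -> V -> T -> V) (j : nat) :
  (forall u w, W 0 u w = u) ->
  (forall t u w, W t.+1 u w = M t.+1 (W t u w) w) ->
  [set w | (tau_coal W w <= (j%:R : R)%:E)%E] =
  [set w | constant_comp
     [ffun i : 'I_j * V => M (backward_index i).1 (backward_index i).2 w]].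
Proof.
move=> W0 WS; apply: eq_set => w; apply/propext.
have Wcomp t u : W t u w = forward_comp (fun s v => M s v w) t u.
  by elim: t => [|t IH]; rewrite ?W0 ?WS ?IH.
have maps u : W j u w = backward_comp (choice_maps
    [ffun i : 'I_j * V => M (backward_index i).1 (backward_index i).2 w]) j u.
  (* Row [t] of the table holds the draws of step [j - t], so the table lists the steps of the walk
     in reverse order. *)
  rewrite Wcomp; apply: forward_comp_rev => t v tj.
  by rewrite (choice_mapsE _ tj).
(* Walkers at the same vertex use the same draw, so they stay together. *)
rewrite first_time_leP => [|t Wt u v]; last by rewrite !WS (Wt u v).
by split=> Wj u v; [rewrite -!maps | rewrite !maps]; exact: Wj.
Qed.

Theorem proposition6p2 (R : realType) (V : finType) (P : nat -> V -> V -> R)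
    (hP : transition_sequence P) :
  exists Q : nat -> nat -> V -> V -> R,
    [/\ forall i, transition_sequence (Q i),
        forall (j : nat)
          (d1 : measure_display) (T1 : measurableType d1)
          (Pr1 : probability T1 R)
          (O : Type) (x0 : V -> O) (X : nat -> V -> T1 -> O)
          (d2 : measure_display) (T2 : measurableType d2)
          (Pr2 : probability T2 R) (W : nat -> V -> T2 -> V),
          injective x0 -> pull_voting Pr1 P x0 X ->
          coalescing_walk Pr2 (Q j) W ->
          Pr1 [set w | (tau_cons X w <= (j%:R : R)%:E)%E] =
          Pr2 [set w | (tau_coal W w <= (j%:R : R)%:E)%E]
      & forall pi : V -> R, reversible_stationary_sequence pi P ->
          forall i, reversible_stationary_sequence pi (Q i)].
Proof.
exists (time_reversal P); split.
- by move=> j t t0; apply/hP/time_reversal_index_gt0.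
- move=> j d1 T1 Pr1 O x0 X d2 T2 Pr2 W x0inj [C hC [X0 XS]] [M hM [W0 WS]].
  have fpos (i : 'I_j * V) : (0 < (forward_index i).1)%N by [].
  have bpos (i : 'I_j * V) : (0 < (backward_index i).1)%N by rewrite subn_gt0.
  rewrite (tau_cons_le R j x0inj X0 XS) (tau_coal_le R j W0 WS) !measure_atoms.
  (* Both probabilities are now sums over the same tables [f]. They agree term by term, each atom
     having the same product of transition probabilities on both sides. *)
  + apply: eq_fsbigr => f _.
    rewrite (random_choices_atom _ hC (@forward_index_inj _ j) fpos).
    rewrite (random_choices_atom _ hM (@backward_index_inj _ j) bpos).
    by apply: eq_bigr => i _; rewrite time_reversal_backward.
  + by move=> i v; case: hM => mM _ _; exact: mM.
  + by move=> i v; case: hC => mC _ _; exact: mC.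
(* Each matrix of the reversal at a positive time is some [P s] with [s > 0], and [pi] serves all of
   these at once. *)
- move=> pi [pi_dist piP] j; split=> // t t0.
  exact/piP/time_reversal_index_gt0.
Qed.
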